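(* Suppose the curved $N$-body problem in $\mathbb H^3$ has a solution of the negative elliptic-hyperbolic form $w_i=r_i(t)\cos[\alpha(t)+a_i]$, $x_i=r_i(t)\sin[\alpha(t)+a_i]$, $y_i=\rho_i(t)\sinh[\beta(t)+b_i]$, $z_i=\rho_i(t)\cosh[\beta(t)+b_i]$, with $a_i,b_i$ constants, $\alpha,\beta$ nonconstant, $z_i\ge1$, $r_i^2-\rho_i^2=-1$, and let $d_1,d_2\ne0$ be the constants for which $\dot\alpha=d_1/\sum_jm_jr_j^2$ and $\dot\beta=d_2/(M+\sum_jm_jr_j^2)$, where $M=\sum_jm_j$. Write $A_i=\alpha+a_i$, $B_i=\beta+b_i$. Then the following expressions are constant in time: (energy) $$h=\sum_{i=1}^N\frac{m_i\dot r_i^2}{2(1+r_i^2)}+\frac{d_1^2}{2\sum_jm_jr_j^2}+\frac{d_2^2}{2(M+\sum_jm_jr_j^2)}+\sum_{1\le i<j\le N}\frac{m_im_jq_{ij}}{(q_{ij}^2-1)^{1/2}};$$ and the total angular momenta relative to the base planes are the constants $c_{wx}=d_1$; $$c_{wy}=-\sum_{i=1}^N\frac{m_i\dot r_i}{(1+r_i^2)^{1/2}}\cos A_i\sinh B_i+\sum_{i=1}^Nm_ir_i(1+r_i^2)^{1/2}[\dot\alpha\sin A_i\sinh B_i+\dot\beta\cos A_i\cosh B_i];$$ $$c_{wz}=-\sum_{i=1}^N\frac{m_i\dot r_i}{(1+r_i^2)^{1/2}}\cos A_i\cosh B_i+\sum_{i=1}^Nm_ir_i(1+r_i^2)^{1/2}[\dot\alpha\sin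 A_i\cosh B_i+\dot\beta\cos A_i\sinh B_i];$$ $$c_{xy}=-\sum_{i=1}^N\frac{m_i\dot r_i}{(1+r_i^2)^{1/2}}\sin A_i\sinh B_i+\sum_{i=1}^Nm_ir_i(1+r_i^2)^{1/2}[\dot\beta\sin A_i\cosh B_i-\dot\alpha\cos A_i\sinh B_i];$$ $$c_{xz}=-\sum_{i=1}^N\frac{m_i\dot r_i}{(1+r_i^2)^{1/2}}\sin A_i\cosh B_i+\sum_{i=1}^Nm_ir_i(1+r_i^2)^{1/2}[\dot\beta\sin A_i\sinh B_i-\dot\alpha\cos A_i\cosh B_i];$$ $c_{yz}=-d_2$.
   Context: Masses $m_1,\dots,m_N>0$, $N\ge2$; dots denote $d/dt$. $\mathbb H^3=\{(w,x,y,z): w^2+x^2+y^2-z^2=-1,\ z>0\}$ in Minkowski space $\mathbb R^{3,1}$, $\cdot$ is the Lorentz inner product of signature $(+,+,+,-)$, $\mathbf q_i=(w_i,x_i,y_i,z_i)$, $q_{ij}:=\mathbf q_i\cdot\mathbf q_j$, $\dot q_{ii}:=\dot{\mathbf q}_i\cdot\dot{\mathbf q}_i$. The curved $N$-body problem in $\mathbb H^3$ is the system $$\ddot{\mathbf q}_i=\sum_{j\ne i}\frac{m_j(\mathbf q_j+q_{ij}\mathbf q_i)}{(q_{ij}^2-1)^{3/2}}+\dot q_{ii}\mathbf q_i,\quad q_{ii}=-1,\quad i=1,\dots,N.$$ The total angular momentum relative to the base plane $uv$, for two of the coordinates $u,v\in\{w,x,y,z\}$ (taken in this order), is $c_{uv}=\sum_{i=1}^Nm_i(u_i\dot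 v_i-\dot u_iv_i)$. The total energy is $h=\frac12\sum_im_i\dot q_{ii}+\sum_{i<j}m_im_jq_{ij}(q_{ij}^2-1)^{-1/2}$. For solutions of the stated form, $\dot\alpha$ and $\dot\beta$ have the expressions in the claim for some nonzero constants $d_1,d_2$. *)

(* Defs.v *)
From mathcomp Require Import all_boot all_order all_algebra.
From mathcomp Require Import all_classical all_reals all_analysis.

Set Implicit Arguments.
Unset Strict Implicit.
Unset Printing Implicit Defensive.

Import Order.TTheory GRing.Theory Num.Theory.
Import numFieldNormedType.Exports.

Local Open Scope classical_set_scope.
Local Open Scope ring_scope.

Definition sinh (R : realType) (x : R) : R := (expR x - expR (- x)) / 2.
Definition cosh (R : realType) (x : R) : R := (expR x + expR (- x)) / 2.

(* A point of R^{3,1} is a row vector with coordinates in the order w, x, y, z;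
   z is the timelike one. *)
Definition cw : 'I_4 := @Ordinal 4 0 isT.
Definition cx : 'I_4 := @Ordinal 4 1 isT.
Definition cy : 'I_4 := @Ordinal 4 2 isT.
Definition cz : 'I_4 := @Ordinal 4 3 isT.

Definition lorentz (R : realType) (p q : 'rV[R]_4) : R :=
  p 0 cw * q 0 cw + p 0 cx * q 0 cx + p 0 cy * q 0 cy - p 0 cz * q 0 cz.

Definition hyperbolic3 (R : realType) : set 'rV[R]_4 :=
  [set p | lorentz p p = -1 /\ 0 < p 0 cz].

Section CurvedNBody.
Context {R : realType} {N : nat}.
Implicit Types (m : 'I_N -> R) (q : 'I_N -> R -> 'rV[R]_4) (t : R).

Definition curved_force m q (i : 'I_N) t : 'rV[R]_4 :=
  \sum_(j < N | j != i)
    (m j / (lorentz (q i t) (q j t) ^+ 2 - 1) `^ (3 / 2)) *: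
      (q j t + lorentz (q i t) (q j t) *: q i t).

(* The separation clause says that no force denominator vanishes: on H^3 one
   has q_ij <= -1, with equality exactly at a collision of bodies i and j. *)
Record curved_Nbody_solution m (J : set R) q : Prop := CurvedNBodySolution {
  sol_H3 : forall i t, J t -> hyperbolic3 (q i t);
  sol_separated : forall i j t, J t -> i != j ->
    1 < lorentz (q i t) (q j t) ^+ 2;
  sol_derivable : forall i t, J t -> derivable (q i) t 1;
  sol_derivable2 : forall i t, J t -> derivable (derive1 (q i)) t 1;
  sol_motion : forall i t, J t ->
    derive1 (derive1 (q i)) t = curved_force m q i t
      + lorentz (derive1 (q i) t) (derive1 (q i) t) *: q i t
}.

Definition angular_momentum m q (u v : 'I_4) t : R :=
  \sum_(i < N) m i * (q i t 0 u * derive1 (q i) t 0 v - derive1 (q i) t 0 u * q i t 0 v).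

Definition interaction_energy m q t : R :=
  \sum_(i < N) \sum_(j < N | (i < j)%N)
    m i * m j * lorentz (q i t) (q j t)
      / Num.sqrt (lorentz (q i t) (q j t) ^+ 2 - 1).

Definition total_energy m q t : R :=
  2^-1 * (\sum_(i < N) m i * lorentz (derive1 (q i) t) (derive1 (q i) t))
    + interaction_energy m q t.

Definition nonconstant_on (J : set R) (f : R -> R) : Prop :=
  exists s t, [/\ J s, J t & f s != f t].

Record negative_elliptic_hyperbolic (J : set R) q (r rho : 'I_N -> R -> R)
    (alpha beta : R -> R) (a b : 'I_N -> R) : Prop :=
  NegativeEllipticHyperbolic {
  neh_w : forall i t, J t -> q i t 0 cw = r i t * cos (alpha t + a i);
  neh_x : forall i t, J t -> q i t 0 cx = r i t * sin (alpha t + a i);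
  neh_y : forall i t, J t -> q i t 0 cy = rho i t * sinh (beta t + b i);
  neh_z : forall i t, J t -> q i t 0 cz = rho i t * cosh (beta t + b i);
  neh_z_ge1 : forall i t, J t -> 1 <= q i t 0 cz;
  neh_radii : forall i t, J t -> r i t ^+ 2 - rho i t ^+ 2 = -1;
  neh_alpha : nonconstant_on J alpha;
  neh_beta : nonconstant_on J beta
}.

Definition elliptic_inertia m (r : 'I_N -> R -> R) t : R :=
  \sum_(j < N) m j * r j t ^+ 2.

End CurvedNBody.

(* Main.v *)
(** The pairwise forces enter [d/dt c_uv] antisymmetrically and cancel against
    the derivative of the potential in [d/dt h] (where [q_i' . q_i = 0] kills
    the remaining terms), so on the interval [J] all these quantities are
    constant; the closed forms come from differentiating the polar
    coordinates with [rho_i = sqrt (1 + r_i ^ 2)].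

    Since [x / 0 = 0], the hypothesis on [alpha'] does not by itself give
    [I = \sum_j m_j r_j ^ 2 <> 0]. But [c_wx = I alpha'] is constant: if [I]
    vanished at one time, [c_wx] would be zero throughout, hence [alpha' = 0]
    throughout, contradicting that [alpha] is nonconstant. *)
Require Import Defs.
From mathcomp Require Import all_boot all_order all_algebra.
From mathcomp Require Import all_classical all_reals all_analysis.
From mathcomp Require Import ring lra.
Set Implicit Arguments.
Unset Strict Implicit.
Unset Printing Implicit Defensive.
Import Order.TTheory GRing.Theory Num.Theory.
Import numFieldNormedType.Exports.
Local Open Scope classical_set_scope.
Local Open Scope ring_scope.

(** * Calculus on an open interval, hyperbolic functions and the pair potential *)

Section Calculus.
Context {R : realType}.
Implicit Types (f g : R -> R) (t : R).

Lemma is_derive_bigsum (I : finType) (P : pred I) (F : I -> R -> R)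
    (dF : I -> R) t :
  (forall i, P i -> is_derive t (1 : R) (F i) (dF i)) ->
  is_derive t (1 : R) (fun s => \sum_(i | P i) F i s) (\sum_(i | P i) dF i).
Proof.
move=> FdF; rewrite (_ : (fun s => _) = \sum_(i | P i) F i); last first.
  by apply/funext => s; rewrite fct_sumE.
elim/big_rec2: _ => [|i df f Pi fdf]; first exact: is_derive_cst.
by apply: is_deriveD => //; exact: FdF.
Qed.

Lemma is_derive_cstM f (k df t : R) :
  is_derive t (1 : R) f df -> is_derive t (1 : R) (fun s => k * f s) (k * df).
Proof. exact: is_deriveZ. Qed.

Lemma is_derive_coord n (p : R -> 'rV[R]_n) t (k : 'I_n) :
  derivable p t 1 -> is_derive t (1 : R) (fun s => p s 0 k) (derive1 p t 0 k).
Proof.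
move=> pt; apply: DeriveDef; first by move/derivable_mxP : pt; exact.
by rewrite derive1E derive_mx// mxE.
Qed.

Lemma is_derive1_eq f t (df : R) : is_derive t (1 : R) f df -> derive1 f t = df.
Proof. by move=> fdf; rewrite derive1E derive_val. Qed.

Lemma derivable_is_derive1 f t :
  derivable f t 1 -> is_derive t (1 : R) f (derive1 f t).
Proof. by move=> ft; apply: DeriveDef => //; rewrite derive1E. Qed.

Lemma near_eq_on_open (J : set R) f g t : open J -> J t ->
  (forall s, J s -> f s = g s) -> \near t, f t = g t.
Proof.
move=> oJ Jt fg; have : nbhs t J by exact: open_nbhs_nbhs.
by apply: filterS => s /fg.
Qed.

(** Derivatives are local and [J] is open, so identities that hold only on [J], such as the polar
    form of the coordinates, may still be differentiated there. *)
Lemma is_derive_eq_on (J : set R) f g t (df : R) : open J -> J t ->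
  (forall s, J s -> f s = g s) ->
  is_derive t (1 : R) g df -> is_derive t (1 : R) f df.
Proof.
move=> oJ Jt fg; apply: near_eq_is_derive.
by apply: near_eq_on_open Jt _ => // s /fg.
Qed.

Lemma is_derive_unique f t (df dg : R) :
  is_derive t (1 : R) f df -> is_derive t (1 : R) f dg -> df = dg.
Proof. by move=> /is_derive1_eq <- /is_derive1_eq <-. Qed.

(** Mean value theorem on the segment between the two times, which lies in [J] because [J] is an
    interval. *)
Lemma is_interval_derive0_cst (J : set R) f :
  is_interval J -> (forall t, J t -> is_derive t (1 : R) f 0) ->
  forall s t, J s -> J t -> f s = f t.
Proof.
move=> itvJ f0 s t; wlog st : s t / s <= t.
  by move=> H Js Jt; case: (leP s t) => [/H|/ltW/H st]; [exact|exact/esym/st].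
move=> Js Jt.
have sub x : x \in `[s, t]%R -> J x.
  by rewrite in_itv/= => xst; exact: itvJ xst.
have [||x _] := @MVT_segment _ f (fun=> 0) _ _ st.
- by move=> x xst; apply: f0; apply: sub; exact: subset_itv_oo_cc xst.
- apply: derivable_within_continuous => x xst.
  by have [] := f0 x (sub _ xst).
- by rewrite mul0r => /eqP; rewrite subr_eq0 => /eqP ->.
Qed.

Lemma is_derive_expRN t : is_derive t (1 : R) (fun x => expR (- x)) (- expR (- t)).
Proof.
have := is_derive1_comp (is_derive_expR (- t)) (is_deriveNid t (1 : R)).
by move/is_derive_eq; apply; rewrite mulrN1.
Qed.

Lemma is_derive_sinh t : is_derive t (1 : R) (@sinh R) (cosh t).
Proof.
have := is_derive_cstM 2^-1 (is_deriveB (is_derive_expR t) (is_derive_expRN t)).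
rewrite (_ : (fun s => _) = @sinh R); last by apply/funext => x; rewrite mulrC.
by move/is_derive_eq; apply; rewrite opprK mulrC.
Qed.

Lemma is_derive_cosh t : is_derive t (1 : R) (@cosh R) (sinh t).
Proof.
have := is_derive_cstM 2^-1 (is_deriveD (is_derive_expR t) (is_derive_expRN t)).
rewrite (_ : (fun s => _) = @cosh R); last by apply/funext => x; rewrite mulrC.
by move/is_derive_eq; apply; rewrite mulrC.
Qed.

Lemma cosh2Bsinh2 (x : R) : cosh x ^+ 2 - sinh x ^+ 2 = 1.
Proof.
have := expRxMexpNx_1 x.
rewrite /cosh /sinh; move: (expR x) (expR (- x)) => u v uv.
by transitivity (u * v); [field|].
Qed.

Lemma cosh_gt0 (x : R) : 0 < cosh x.
Proof. by rewrite divr_gt0// addr_gt0// expR_gt0. Qed.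

(** Turns the real power of the force law into an integer power of a square root, on which [field]
    can compute. *)
Lemma powR3half (x : R) : 0 < x -> x `^ (3 / 2) = Num.sqrt x ^+ 3.
Proof.
by move=> x0; rewrite mulrC powRrM powR12_sqrt ?ltW// powR_mulrn ?sqrtr_ge0.
Qed.

(** With [u = sqrt (f^2 - 1)] the quotient rule gives [(u^2 - f^2) f' / u^3], whose first factor is
    [-1]. This is how the exponent 1/2 of the potential produces the exponent 3/2 of the force. *)
Lemma is_derive_potential (f : R -> R) t (df : R) :
  1 < f t ^+ 2 -> is_derive t (1 : R) f df ->
  is_derive t (1 : R) (fun s => f s / Num.sqrt (f s ^+ 2 - 1))
    (- (df / (f t ^+ 2 - 1) `^ (3 / 2))).
Proof.
move=> f1 fdf.
have p0 : 0 < f t ^+ 2 - 1 by rewrite subr_gt0.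
have s0 : Num.sqrt (f t ^+ 2 - 1) != 0 by rewrite gt_eqF// sqrtr_gt0.
have dp : is_derive t (1 : R) (fun s => f s ^+ 2 - 1) (2 * f t * df).
  have := is_deriveB (is_deriveX 2 fdf) (is_derive_cst (1 : R) t 1).
  (* The derivative rules use module scaling, which over [R] is multiplication by conversion; the
     pattern exposes the product to [ring]. *)
  move/is_derive_eq; apply; rewrite /= subr0 expr1 -[_ *: _]/(_ * _); ring.
have ds := @is_derive1_comp _ Num.sqrt (fun s => f s ^+ 2 - 1) _ _ _
  (is_derive1_sqrt p0) dp.
have := is_deriveM fdf
  (@is_deriveV _ (Num.sqrt \o fun s => f s ^+ 2 - 1) _ _ _ s0 ds).
move/is_derive_eq; apply.
rewrite powR3half// /= -![_ *: _]/(_ * _).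
have uE := sqr_sqrtr (ltW p0); move: s0 uE; set u : R := Num.sqrt _ => u0 uE.
transitivity ((u ^+ 2 - f t ^+ 2) * df / u ^+ 3); first by field.
by rewrite uE; field.
Qed.

End Calculus.

(** * Bilinearity of the Lorentz product and its product rule *)

Section Lorentz.
Context {R : realType}.
Implicit Types (p q u v : 'rV[R]_4) (t : R).

Lemma lorentzC p q : lorentz p q = lorentz q p.
Proof. by rewrite /lorentz ![p 0 _ * _]mulrC. Qed.

Lemma lorentzDr p u v : lorentz p (u + v) = lorentz p u + lorentz p v.
Proof. by rewrite /lorentz !mxE; ring. Qed.

Lemma lorentzZr (k : R) p u : lorentz p (k *: u) = k * lorentz p u.
Proof. by rewrite /lorentz !mxE; ring. Qed.

Lemma lorentz_sumr (I : finType) (P : pred I) p (F : I -> 'rV[R]_4) :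
  lorentz p (\sum_(i | P i) F i) = \sum_(i | P i) lorentz p (F i).
Proof.
elim/big_rec2: _ => [|i u v _ <-]; last exact: lorentzDr.
by rewrite /lorentz !mxE; ring.
Qed.

Lemma is_derive_lorentz (f g : R -> 'rV[R]_4) t :
  derivable f t 1 -> derivable g t 1 ->
  is_derive t (1 : R) (fun s => lorentz (f s) (g s))
    (lorentz (derive1 f t) (g t) + lorentz (f t) (derive1 g t)).
Proof.
move=> ft gt.
have dM k := is_deriveM (is_derive_coord k ft) (is_derive_coord k gt).
have := is_deriveB (is_deriveD (is_deriveD (dM cw) (dM cx)) (dM cy)) (dM cz).
move/is_derive_eq; apply.
by rewrite /lorentz -![_ *: _]/(_ * _); ring.
Qed.

End Lorentz.

(** Lets mutual contributions of two bodies cancel pair by pair. The terms with [j < i] come from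
    exchanging the two summations. *)
Lemma sum_offdiag_pairs (V : zmodType) N (F : 'I_N -> 'I_N -> V) :
  \sum_(i < N) \sum_(j < N | j != i) F i j =
  \sum_(i < N) \sum_(j < N | (i < j)%N) (F i j + F j i).
Proof.
under [RHS]eq_bigr do rewrite big_split/=.
rewrite big_split/= [X in _ = _ + X](exchange_big_dep xpredT)//= -big_split/=.
apply: eq_bigr => i _; rewrite (bigID (fun j : 'I_N => (i < j)%N))/=.
congr (_ + _); apply: eq_bigl => j.
  by rewrite -val_eqE/= neq_ltn; case: ltngtP.
by rewrite -val_eqE/= neq_ltn; case: ltngtP.
Qed.

(** * Conservation of angular momentum and energy for any solution *)

Section Conservation.
Context {R : realType} {N : nat}.
Variables (m : 'I_N -> R) (J : set R) (q : 'I_N -> R -> 'rV[R]_4).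
Hypothesis oJ : open J.
Hypothesis sol : curved_Nbody_solution m J q.

Let position_derivable i t : J t -> derivable (q i) t 1.
Proof. by move=> Jt; exact: (sol_derivable sol Jt). Qed.
Arguments position_derivable : clear implicits.

Let velocity_derivable i t : J t -> derivable (derive1 (q i)) t 1.
Proof. by move=> Jt; exact: (sol_derivable2 sol Jt). Qed.
Arguments velocity_derivable : clear implicits.

(** Obtained by differentiating the constraint [q_i . q_i = -1], which holds on the open set [J]. *)
Lemma lorentz_velocity i t : J t -> lorentz (derive1 (q i) t) (q i t) = 0.
Proof.
move=> Jt; have qt := position_derivable i t Jt.
have d0 : is_derive t (1 : R) (fun s => lorentz (q i s) (q i s)) 0.
  apply: (is_derive_eq_on oJ Jt _ (is_derive_cst (-1 : R) t 1)).
  by move=> s Js; have [] := sol_H3 sol i Js.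
have := is_derive_unique (is_derive_lorentz qt qt) d0.
by rewrite (lorentzC (q i t)); lra.
Qed.

(** The mass of body [i] is included to make the coefficient symmetric in the two bodies, as the
    pairwise cancellations require. *)
Let force_coef i j t := m i * m j / (lorentz (q i t) (q j t) ^+ 2 - 1) `^ (3 / 2).

Let force_coefC i j t : force_coef i j t = force_coef j i t.
Proof. by rewrite /force_coef lorentzC (mulrC (m i)). Qed.

Lemma curved_forceE i t k : curved_force m q i t 0 k =
  \sum_(j < N | j != i) m j / (lorentz (q i t) (q j t) ^+ 2 - 1) `^ (3 / 2) *
    (q j t 0 k + lorentz (q i t) (q j t) * q i t 0 k).
Proof. by rewrite summxE; apply: eq_bigr => j _; rewrite !mxE. Qed.

Lemma angular_momentum_is_derive0 (u v : 'I_4) t : J t ->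
  is_derive t (1 : R) (angular_momentum m q u v) 0.
Proof.
move=> Jt.
have dq i k := is_derive_coord k (position_derivable i t Jt).
have dv i k := is_derive_coord k (velocity_derivable i t Jt).
have := is_derive_bigsum (fun (i : 'I_N) (_ : true) => is_derive_cstM (m i)
  (is_deriveB (is_deriveM (dq i u) (dv i v)) (is_deriveM (dv i u) (dq i v)))).
move/is_derive_eq; apply.
pose D i j := (lorentz (q i t) (q j t) ^+ 2 - 1) `^ (3 / 2).
(* The products of two velocities cancel, and every part of the acceleration along [q_i] drops out
   of [u v'' - u'' v]. Only the pull towards [q_j] is left. *)
transitivity (\sum_(i < N) \sum_(j < N | j != i)
  force_coef i j t * (q i t 0 u * q j t 0 v - q j t 0 u * q i t 0 v)).
  apply: eq_bigr => i _; rewrite -![_ *: _]/(_ * _).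
  rewrite (sol_motion sol)// !(curved_forceE, mxE).
  transitivity (m i * (q i t 0 u * \sum_(j < N | j != i) m j / D i j *
        (q j t 0 v + lorentz (q i t) (q j t) * q i t 0 v)
      - q i t 0 v * \sum_(j < N | j != i) m j / D i j *
        (q j t 0 u + lorentz (q i t) (q j t) * q i t 0 u))); first by ring.
  rewrite !mulr_sumr -sumrN -big_split/= mulr_sumr.
  by apply: eq_bigr => j _; rewrite /force_coef -/(D i j); ring.
(* The coefficient is symmetric and the bracket antisymmetric in [i] and [j], so each pair
   contributes zero. *)
rewrite sum_offdiag_pairs big1// => i _; rewrite big1// => j _.
by rewrite (force_coefC j i); ring.
Qed.

Lemma total_energy_is_derive0 t : J t -> is_derive t (1 : R) (total_energy m q) 0.
Proof.
move=> Jt.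
(* Power of the forces: the components of the acceleration along [q_i] do no work, since
   [q_i' . q_i = 0]. *)
have dT : is_derive t (1 : R)
    (fun s => 2^-1 * \sum_(i < N) m i * lorentz (derive1 (q i) s) (derive1 (q i) s))
    (\sum_(i < N) \sum_(j < N | j != i)
      force_coef i j t * lorentz (derive1 (q i) t) (q j t)).
  have dv i := is_derive_lorentz (velocity_derivable i t Jt) (velocity_derivable i t Jt).
  have := is_derive_cstM 2^-1 (is_derive_bigsum
    (fun (i : 'I_N) (_ : true) => is_derive_cstM (m i) (dv i))).
  move/is_derive_eq; apply; rewrite mulr_sumr; apply: eq_bigr => i _.
  rewrite [X in X + _]lorentzC (sol_motion sol)// lorentzDr lorentzZr lorentz_velocity//.
  rewrite lorentz_sumr mulr0 addr0.
  transitivity (m i * \sum_(j < N | j != i)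
      lorentz (derive1 (q i) t)
        ((m j / (lorentz (q i t) (q j t) ^+ 2 - 1) `^ (3 / 2)) *:
          (q j t + lorentz (q i t) (q j t) *: q i t))); first by field.
  rewrite mulr_sumr; apply: eq_bigr => j _.
  by rewrite lorentzZr lorentzDr lorentzZr lorentz_velocity// /force_coef; ring.
have dU : is_derive t (1 : R) (interaction_energy m q)
    (\sum_(i < N) \sum_(j < N | (i < j)%N) - (force_coef i j t *
      (lorentz (derive1 (q i) t) (q j t) + lorentz (q i t) (derive1 (q j) t)))).
  apply: is_derive_bigsum => i _; apply: is_derive_bigsum => j ij.
  have sep : 1 < lorentz (q i t) (q j t) ^+ 2.
    by apply: (sol_separated sol) => //; rewrite -val_eqE/= neq_ltn ij.
  have := @is_derive_potential _ (fun s => lorentz (q i s) (q j s)) _ _ sep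
    (is_derive_lorentz (position_derivable i t Jt) (position_derivable j t Jt)).
  move/(is_derive_cstM (m i * m j)).
  rewrite (_ : (fun s => _) = fun s => m i * m j * lorentz (q i s) (q j s)
      / Num.sqrt (lorentz (q i s) (q j s) ^+ 2 - 1)); last first.
    by apply/funext => s; rewrite mulrA.
  by move/is_derive_eq; apply; rewrite /force_coef; ring.
have := is_deriveD dT dU; move/is_derive_eq; apply.
(* Folded onto [i < j], the power of each pair is the opposite of the derivative of its
   potential. *)
rewrite sum_offdiag_pairs -big_split big1//= => i _; rewrite -big_split big1//= => j _.
by rewrite (force_coefC j i) (lorentzC (q i t)); ring.
Qed.

End Conservation.

(** * Velocities, momenta and energy in the polar coordinates *)

Section Kinematics.
Context {R : realType} {N : nat}.
Variables (J : set R) (q : 'I_N -> R -> 'rV[R]_4) (r rho : 'I_N -> R -> R).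
Variables (alpha beta : R -> R) (a b : 'I_N -> R).
Hypothesis oJ : open J.
Hypothesis q_derivable : forall i t, J t -> derivable (q i) t 1.
Hypothesis form : negative_elliptic_hyperbolic J q r rho alpha beta a b.
Hypothesis alpha_derivable : forall t, J t -> derivable alpha t 1.
Hypothesis beta_derivable : forall t, J t -> derivable beta t 1.

Let A i t := alpha t + a i.
Let B i t := beta t + b i.

(** The constraint on the radii fixes only [rho^2]; the sign comes from [z >= 1] and [cosh > 0]. *)
Lemma rhoE i t : J t -> rho i t = Num.sqrt (1 + r i t ^+ 2).
Proof.
move=> Jt; have rho_gt0 : 0 < rho i t.
  rewrite -(pmulr_lgt0 _ (cosh_gt0 (beta t + b i))) -(neh_z form)//.
  exact: lt_le_trans ltr01 (neh_z_ge1 form i Jt).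
rewrite (_ : 1 + _ = rho i t ^+ 2); last by have := neh_radii form i Jt; lra.
by rewrite sqrtr_sqr gtr0_norm.
Qed.

Lemma rho_gt0 i t : J t -> 0 < rho i t.
Proof. by move=> Jt; rewrite rhoE// sqrtr_gt0 ltr_wpDr// sqr_ge0. Qed.

Lemma is_derive_shift_comp (f theta : R -> R) (c df t : R) :
  derivable theta t 1 -> is_derive (theta t + c) (1 : R) f df ->
  is_derive t (1 : R) (fun s => f (theta s + c)) (df * derive1 theta t).
Proof.
move=> /derivable_is_derive1 dtheta fdf.
have := is_deriveD dtheta (is_derive_cst c t (1 : R)); rewrite addr0.
exact: (@is_derive1_comp _ f (fun s => theta s + c)).
Qed.

(** Differentiability of [r] is recovered from [r = w cos A + x sin A], a formula valid for either
    sign of [r] and also at its zeros. *)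
Lemma is_derive_radius i t : J t -> is_derive t (1 : R) (r i) (derive1 (r i) t).
Proof.
move=> Jt; have dA := alpha_derivable Jt.
have dq k := is_derive_coord k (@q_derivable i _ Jt).
have dcos := is_derive_shift_comp dA (is_derive_cos (alpha t + a i)).
have dsin := is_derive_shift_comp dA (is_derive_sin (alpha t + a i)).
have dr := is_deriveD (is_deriveM (dq cw) dcos) (is_deriveM (dq cx) dsin).
have rE s : J s -> r i s =
    q i s 0 cw * cos (alpha s + a i) + q i s 0 cx * sin (alpha s + a i).
  move=> Js; rewrite (neh_w form)// (neh_x form)//.
  by rewrite -!mulrA -!expr2 -mulrDr cos2Dsin2 mulr1.
by have [? _] := is_derive_eq_on oJ Jt rE dr; exact: derivable_is_derive1.
Qed.

Lemma is_derive_rho i t : J t ->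
  is_derive t (1 : R) (rho i) (r i t * derive1 (r i) t / rho i t).
Proof.
move=> Jt.
have p0 : 0 < 1 + r i t ^+ 2 by rewrite ltr_wpDr// sqr_ge0.
have dr := is_deriveD (is_derive_cst (1 : R) t 1)
  (is_deriveX 2 (is_derive_radius i Jt)).
have := @is_derive1_comp _ Num.sqrt (fun s => 1 + r i s ^+ 2) _ _ _
  (is_derive1_sqrt p0) dr.
move/(is_derive_eq_on oJ Jt (@rhoE i))/is_derive_eq; apply.
rewrite rhoE//= add0r expr1 -[_ *: _]/(_ * _).
have : Num.sqrt (1 + r i t ^+ 2) != 0 by rewrite gt_eqF// sqrtr_gt0.
by move=> ?; field.
Qed.

(** The coordinate of the velocity and the derivative of the polar formula are derivatives of the
    same function near [t], hence equal. The other three coordinates are treated alike. *)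
Lemma velocity_w i t : J t -> derive1 (q i) t 0 cw =
  derive1 (r i) t * cos (A i t) - r i t * sin (A i t) * derive1 alpha t.
Proof.
move=> Jt; have dr := is_derive_radius i Jt.
have dA := is_derive_shift_comp (alpha_derivable Jt) (is_derive_cos (A i t)).
have := is_derive_unique (is_derive_coord cw (@q_derivable i _ Jt))
  (is_derive_eq_on oJ Jt (neh_w form i) (is_deriveM dr dA)).
by move=> ->; rewrite -![_ *: _]/(_ * _) /A; ring.
Qed.

Lemma velocity_x i t : J t -> derive1 (q i) t 0 cx =
  derive1 (r i) t * sin (A i t) + r i t * cos (A i t) * derive1 alpha t.
Proof.
move=> Jt; have dr := is_derive_radius i Jt.
have dA := is_derive_shift_comp (alpha_derivable Jt) (is_derive_sin (A i t)).
have := is_derive_unique (is_derive_coord cx (@q_derivable i _ Jt))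
  (is_derive_eq_on oJ Jt (neh_x form i) (is_deriveM dr dA)).
by move=> ->; rewrite -![_ *: _]/(_ * _) /A; ring.
Qed.

Lemma velocity_y i t : J t -> derive1 (q i) t 0 cy =
  r i t * derive1 (r i) t / rho i t * sinh (B i t)
  + rho i t * cosh (B i t) * derive1 beta t.
Proof.
move=> Jt; have dr := is_derive_rho i Jt.
have dB := is_derive_shift_comp (beta_derivable Jt) (is_derive_sinh (B i t)).
have := is_derive_unique (is_derive_coord cy (@q_derivable i _ Jt))
  (is_derive_eq_on oJ Jt (neh_y form i) (is_deriveM dr dB)).
by move=> ->; rewrite -![_ *: _]/(_ * _) /B; ring.
Qed.

Lemma velocity_z i t : J t -> derive1 (q i) t 0 cz =
  r i t * derive1 (r i) t / rho i t * cosh (B i t)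
  + rho i t * sinh (B i t) * derive1 beta t.
Proof.
move=> Jt; have dr := is_derive_rho i Jt.
have dB := is_derive_shift_comp (beta_derivable Jt) (is_derive_cosh (B i t)).
have := is_derive_unique (is_derive_coord cz (@q_derivable i _ Jt))
  (is_derive_eq_on oJ Jt (neh_z form i) (is_deriveM dr dB)).
by move=> ->; rewrite -![_ *: _]/(_ * _) /B; ring.
Qed.

Lemma lorentz_velocity_velocity i t : J t ->
  lorentz (derive1 (q i) t) (derive1 (q i) t) =
  derive1 (r i) t ^+ 2 / (1 + r i t ^+ 2) + r i t ^+ 2 * derive1 alpha t ^+ 2
  + (1 + r i t ^+ 2) * derive1 beta t ^+ 2.
Proof.
move=> Jt; rewrite /lorentz velocity_w// velocity_x// velocity_y// velocity_z//.
have := cosh2Bsinh2 (B i t); have := cos2Dsin2 (A i t).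
have := neh_radii form i Jt; have := rho_gt0 i Jt.
move: (cosh _) (sinh _) (cos _) (sin _) (rho i t) (r i t) => C S c s p x p0 px cs CS.
have p_neq0 : p != 0 by rewrite gt_eqF.
rewrite (_ : 1 + x ^+ 2 = p ^+ 2); last by lra.
(* The cross terms cancel within the [w, x] plane and, by the Lorentz sign, within the [y, z] plane,
   which leaves only the two Pythagorean combinations. *)
transitivity (derive1 (r i) t ^+ 2 * (c ^+ 2 + s ^+ 2)
  + x ^+ 2 * derive1 alpha t ^+ 2 * (c ^+ 2 + s ^+ 2)
  + (p ^+ 2 * derive1 beta t ^+ 2 - (x * derive1 (r i) t / p) ^+ 2)
    * (C ^+ 2 - S ^+ 2)); first by field.
(* The radial parts combine to [r'^2 (1 - r^2 / rho^2)], which is [r'^2 / rho^2] because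
   [rho^2 - r^2 = 1]. *)
rewrite cs CS; transitivity
  (derive1 (r i) t ^+ 2 * (p ^+ 2 - x ^+ 2) / p ^+ 2 +
    x ^+ 2 * derive1 alpha t ^+ 2 + p ^+ 2 * derive1 beta t ^+ 2); first by field.
by rewrite (_ : p ^+ 2 - x ^+ 2 = 1) ?mulr1//; lra.
Qed.

Variable m : 'I_N -> R.

Lemma angular_momentum_wx t : J t ->
  angular_momentum m q cw cx t = elliptic_inertia m r t * derive1 alpha t.
Proof.
move=> Jt; rewrite /elliptic_inertia mulr_suml; apply: eq_bigr => i _.
rewrite velocity_w// velocity_x// (neh_w form)// (neh_x form)// -/(A i t).
transitivity (m i * r i t ^+ 2 * derive1 alpha t
  * (cos (A i t) ^+ 2 + sin (A i t) ^+ 2)); first by ring.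
by rewrite cos2Dsin2 mulr1.
Qed.

(** The minus sign is that of [sinh^2 - cosh^2 = -1]; the total mass appears through
    [rho^2 = 1 + r^2]. *)
Lemma angular_momentum_yz t : J t ->
  angular_momentum m q cy cz t =
  - ((\sum_(i < N) m i + elliptic_inertia m r t) * derive1 beta t).
Proof.
move=> Jt; rewrite /elliptic_inertia -big_split/= mulr_suml -sumrN.
apply: eq_bigr => i _.
rewrite velocity_y// velocity_z// (neh_y form)// (neh_z form)// -/(B i t).
have p2 : m i + m i * r i t ^+ 2 = m i * rho i t ^+ 2.
  by have := neh_radii form i Jt => /(canRL (subrK _)) ->; ring.
transitivity (- (m i * rho i t ^+ 2 * derive1 beta t
  * (cosh (B i t) ^+ 2 - sinh (B i t) ^+ 2))); first by ring.
by rewrite cosh2Bsinh2 mulr1 p2.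
Qed.

(* For the four mixed planes the radial part [r rho' - r' rho] equals
   [- r' / rho], because [rho' = r r' / rho] and [r^2 - rho^2 = -1]. *)
Let mixed_momentum (u v : 'I_4) (U U' V V' : 'I_N -> R) t : J t ->
  (forall i, q i t 0 u = r i t * U i) ->
  (forall i, q i t 0 v = rho i t * V i) ->
  (forall i, derive1 (q i) t 0 u =
     derive1 (r i) t * U i + r i t * U' i * derive1 alpha t) ->
  (forall i, derive1 (q i) t 0 v =
     r i t * derive1 (r i) t / rho i t * V i + rho i t * V' i * derive1 beta t) ->
  angular_momentum m q u v t =
  - (\sum_(i < N) m i * derive1 (r i) t / Num.sqrt (1 + r i t ^+ 2) * U i * V i)
  + \sum_(i < N) m i * r i t * Num.sqrt (1 + r i t ^+ 2)
     * (derive1 beta t * U i * V' i - derive1 alpha t * U' i * V i).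
Proof.
move=> Jt qu qv vu vv; rewrite -sumrN -big_split/=; apply: eq_bigr => i _.
rewrite qu qv vu vv -rhoE//.
have p_neq0 : rho i t != 0 by rewrite gt_eqF// rho_gt0.
transitivity (m i * derive1 (r i) t * U i * V i
    * (r i t ^+ 2 - rho i t ^+ 2) / rho i t
  + m i * r i t * rho i t
     * (derive1 beta t * U i * V' i - derive1 alpha t * U' i * V i)); first by field.
by rewrite (neh_radii form)//; field.
Qed.

Lemma angular_momentum_wy t : J t -> angular_momentum m q cw cy t =
  - (\sum_(i < N) m i * derive1 (r i) t / Num.sqrt (1 + r i t ^+ 2)
       * cos (A i t) * sinh (B i t))
  + \sum_(i < N) m i * r i t * Num.sqrt (1 + r i t ^+ 2)
      * (derive1 alpha t * sin (A i t) * sinh (B i t)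
         + derive1 beta t * cos (A i t) * cosh (B i t)).
Proof.
(* The primed arguments are the derivatives of the angular factors in their angle; the minus sign of
   [- sin] makes the [alpha'] term positive. *)
move=> Jt; rewrite (@mixed_momentum _ _ (fun i => cos (A i t))
  (fun i => - sin (A i t)) (fun i => sinh (B i t)) (fun i => cosh (B i t)))//.
- by congr (_ + _); apply: eq_bigr => i _; ring.
- by move=> i; exact: neh_w form _ _ _.
- by move=> i; exact: neh_y form _ _ _.
- by move=> i; rewrite velocity_w//; ring.
- by move=> i; rewrite velocity_y.
Qed.

Lemma angular_momentum_wz t : J t -> angular_momentum m q cw cz t =
  - (\sum_(i < N) m i * derive1 (r i) t / Num.sqrt (1 + r i t ^+ 2)
       * cos (A i t) * cosh (B i t))
  + \sum_(i < N) m i * r i t * Num.sqrt (1 + r i t ^+ 2)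
      * (derive1 alpha t * sin (A i t) * cosh (B i t)
         + derive1 beta t * cos (A i t) * sinh (B i t)).
Proof.
move=> Jt; rewrite (@mixed_momentum _ _ (fun i => cos (A i t))
  (fun i => - sin (A i t)) (fun i => cosh (B i t)) (fun i => sinh (B i t)))//.
- by congr (_ + _); apply: eq_bigr => i _; ring.
- by move=> i; exact: neh_w form _ _ _.
- by move=> i; exact: neh_z form _ _ _.
- by move=> i; rewrite velocity_w//; ring.
- by move=> i; rewrite velocity_z.
Qed.

Lemma angular_momentum_xy t : J t -> angular_momentum m q cx cy t =
  - (\sum_(i < N) m i * derive1 (r i) t / Num.sqrt (1 + r i t ^+ 2)
       * sin (A i t) * sinh (B i t))
  + \sum_(i < N) m i * r i t * Num.sqrt (1 + r i t ^+ 2)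
      * (derive1 beta t * sin (A i t) * cosh (B i t)
         - derive1 alpha t * cos (A i t) * sinh (B i t)).
Proof.
move=> Jt; apply: mixed_momentum => // i.
- exact: neh_x form _ _ _.
- exact: neh_y form _ _ _.
- exact: velocity_x.
- exact: velocity_y.
Qed.

Lemma angular_momentum_xz t : J t -> angular_momentum m q cx cz t =
  - (\sum_(i < N) m i * derive1 (r i) t / Num.sqrt (1 + r i t ^+ 2)
       * sin (A i t) * cosh (B i t))
  + \sum_(i < N) m i * r i t * Num.sqrt (1 + r i t ^+ 2)
      * (derive1 beta t * sin (A i t) * sinh (B i t)
         - derive1 alpha t * cos (A i t) * cosh (B i t)).
Proof.
move=> Jt; apply: mixed_momentum => // i.
- exact: neh_x form _ _ _.
- exact: neh_z form _ _ _.
- exact: velocity_x.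
- exact: velocity_z.
Qed.

(** Here [alpha'] and [beta'] are kept, so no inertia occurs in a denominator yet. *)
Lemma total_energyE t : J t -> total_energy m q t =
  \sum_(i < N) m i * derive1 (r i) t ^+ 2 / (2 * (1 + r i t ^+ 2))
  + elliptic_inertia m r t * derive1 alpha t ^+ 2 / 2
  + (\sum_(i < N) m i + elliptic_inertia m r t) * derive1 beta t ^+ 2 / 2
  + interaction_energy m q t.
Proof.
move=> Jt; congr (_ + _).
rewrite /elliptic_inertia -big_split/= !mulr_suml mulr_sumr -!big_split/=.
apply: eq_bigr => i _; rewrite lorentz_velocity_velocity//.
have : 1 + r i t ^+ 2 != 0 by rewrite gt_eqF// ltr_wpDr// sqr_ge0.
by move=> ?; field.
Qed.

End Kinematics.

(** * Constancy in time combined with the closed forms *)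

Theorem proposition11 (R : realType) (N : nat) (hN : (2 <= N)%N)
    (m : 'I_N -> R) (hm : forall i, 0 < m i)
    (J : set R) (hJ : open J) (hJitv : is_interval J)
    (q : 'I_N -> R -> 'rV[R]_4)
    (r rho : 'I_N -> R -> R) (alpha beta : R -> R) (a b : 'I_N -> R)
    (d1 d2 : R)
    (hsol : curved_Nbody_solution m J q)
    (hform : negative_elliptic_hyperbolic J q r rho alpha beta a b)
    (hd1 : d1 != 0) (hd2 : d2 != 0)
    (halpha : forall t, J t -> derivable alpha t 1 /\
       derive1 alpha t = d1 / elliptic_inertia m r t)
    (hbeta : forall t, J t -> derivable beta t 1 /\
       derive1 beta t = d2 / (\sum_(j < N) m j + elliptic_inertia m r t)) :
  let A i t := alpha t + a i in
  let B i t := beta t + b i in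
  exists h cwy cwz cxy cxz : R, forall t, J t ->
    [/\ total_energy m q t = h /\
        h = \sum_(i < N) m i * derive1 (r i) t ^+ 2 / (2 * (1 + r i t ^+ 2))
            + d1 ^+ 2 / (2 * elliptic_inertia m r t)
            + d2 ^+ 2 / (2 * (\sum_(j < N) m j + elliptic_inertia m r t))
            + interaction_energy m q t,
        angular_momentum m q cw cx t = d1 /\
        angular_momentum m q cy cz t = - d2,
        angular_momentum m q cw cy t = cwy /\
        cwy = - (\sum_(i < N) m i * derive1 (r i) t / Num.sqrt (1 + r i t ^+ 2)
                   * cos (A i t) * sinh (B i t))
            + \sum_(i < N) m i * r i t * Num.sqrt (1 + r i t ^+ 2)
                * (derive1 alpha t * sin (A i t) * sinh (B i t)
                   + derive1 beta t * cos (A i t) * cosh (B i t)),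
        angular_momentum m q cw cz t = cwz /\
        cwz = - (\sum_(i < N) m i * derive1 (r i) t / Num.sqrt (1 + r i t ^+ 2)
                   * cos (A i t) * cosh (B i t))
            + \sum_(i < N) m i * r i t * Num.sqrt (1 + r i t ^+ 2)
                * (derive1 alpha t * sin (A i t) * cosh (B i t)
                   + derive1 beta t * cos (A i t) * sinh (B i t))
      & (angular_momentum m q cx cy t = cxy /\
         cxy = - (\sum_(i < N) m i * derive1 (r i) t / Num.sqrt (1 + r i t ^+ 2)
                    * sin (A i t) * sinh (B i t))
             + \sum_(i < N) m i * r i t * Num.sqrt (1 + r i t ^+ 2)
                 * (derive1 beta t * sin (A i t) * cosh (B i t)
                    - derive1 alpha t * cos (A i t) * sinh (B i t))) /\
        (angular_momentum m q cx cz t = cxz /\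
         cxz = - (\sum_(i < N) m i * derive1 (r i) t / Num.sqrt (1 + r i t ^+ 2)
                    * sin (A i t) * cosh (B i t))
             + \sum_(i < N) m i * r i t * Num.sqrt (1 + r i t ^+ 2)
                 * (derive1 beta t * sin (A i t) * sinh (B i t)
                    - derive1 alpha t * cos (A i t) * cosh (B i t)))].
Proof.
move=> A B.
have a_der t : J t -> derivable alpha t 1 by move=> /halpha[].
have b_der t : J t -> derivable beta t 1 by move=> /hbeta[].
have q_der i t : J t -> derivable (q i) t 1.
  by move=> Jt; exact: (sol_derivable hsol Jt).
(* Nonconstancy of [alpha] provides a time in [J]; all the constants are values at this time. *)
have [t0 [_ [Jt0 _ _]]] := neh_alpha hform.
have c_cst u v t : J t -> angular_momentum m q u v t = angular_momentum m q u v t0.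
  move=> Jt; apply: is_interval_derive0_cst hJitv _ _ _ Jt Jt0 => s Js.
  exact: angular_momentum_is_derive0 hsol _ _ _ Js.
have I_neq0 t : J t -> elliptic_inertia m r t != 0.
  move=> Jt; apply/eqP => It0; have [s1 [s2 [Js1 Js2 /eqP]]] := neh_alpha hform.
  apply; apply: is_interval_derive0_cst hJitv _ _ _ Js1 Js2 => s Js.
  have [ds dsE] := halpha _ Js; suff <- : derive1 alpha s = 0.
    exact: derivable_is_derive1.
  (* If the inertia vanishes at [s], then [alpha'] is zero by the convention for division by zero;
     otherwise [I alpha' = 0] at [s], by conservation of [c_wx], forces it. *)
  have [Is0|Is0] := eqVneq (elliptic_inertia m r s) 0.
    by rewrite dsE Is0 invr0 mulr0.
  have := c_cst cw cx s Js; rewrite -(c_cst cw cx t Jt).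
  rewrite !(angular_momentum_wx hJ q_der hform a_der)// It0 mul0r.
  by move/eqP; rewrite mulf_eq0 (negbTE Is0)/= => /eqP.
have MI_neq0 t : J t -> \sum_(j < N) m j + elliptic_inertia m r t != 0.
  move=> Jt; rewrite gt_eqF// ltr_wpDr//.
    by apply: sumr_ge0 => i _; rewrite mulr_ge0 ?sqr_ge0// ltW.
  (* Body 0 exists since [2 <= N], and its mass alone makes the total mass positive. *)
  pose i0 : 'I_N := Ordinal (ltnW hN).
  by rewrite (bigD1 i0)//= ltr_pwDl// sumr_ge0// => i _; rewrite ltW.
exists (total_energy m q t0), (angular_momentum m q cw cy t0),
  (angular_momentum m q cw cz t0), (angular_momentum m q cx cy t0),
  (angular_momentum m q cx cz t0) => t Jt.
have h_cst : total_energy m q t = total_energy m q t0.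
  apply: is_interval_derive0_cst hJitv _ _ _ Jt Jt0 => s Js.
  exact: total_energy_is_derive0 hJ hsol _ Js.
have I0 := I_neq0 t Jt; have MI0 := MI_neq0 t Jt.
have [_ aE] := halpha t Jt; have [_ bE] := hbeta t Jt.
split; first split.
- exact: h_cst.
(* Substituting [alpha' = d1 / I] turns [I alpha'^2 / 2] into [d1^2 / (2 I)], and similarly for
   [beta']; [I0] and [MI0] justify the cancellations. *)
- rewrite -h_cst (total_energyE hJ q_der hform a_der b_der m Jt) aE bE.
  by congr (_ + _ + _ + _); field.
- rewrite (angular_momentum_wx hJ q_der hform a_der m Jt).
  rewrite (angular_momentum_yz hJ q_der hform a_der b_der m Jt) aE bE.
  by split; field.
(* The constant is traded back for the value at [t], where the closed form applies. *)
- split; rewrite ?c_cst// -(c_cst _ _ t)//.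
  exact: (angular_momentum_wy hJ q_der hform a_der b_der m Jt).
- split; rewrite ?c_cst// -(c_cst _ _ t)//.
  exact: (angular_momentum_wz hJ q_der hform a_der b_der m Jt).
- split; (split; first by rewrite c_cst); rewrite -(c_cst _ _ t)//.
    exact: (angular_momentum_xy hJ q_der hform a_der b_der m Jt).
  exact: (angular_momentum_xz hJ q_der hform a_der b_der m Jt).
Qed.
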